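(* For any integer $n \geq 1$, $|\mathcal{F}(n; 213, 231)| = F_{n}$, where $F_{n}$ is the $n$-th Fibonacci number with initial conditions $F_{1} = F_{2} = 1$.
   Context: For a positive integer $n$, $[n]=\{1,\dots,n\}$, and a permutation $\sigma$ of $[n]$ is written as the word $\sigma(1)\sigma(2)\cdots\sigma(n)$. A run of $\sigma$ is a maximal block of consecutive positions on which $\sigma$ is increasing, so $\sigma$ is uniquely the concatenation of its runs; the starting point of a run is its first entry. A flattened partition over $[n]$ is a permutation of $[n]$ whose runs, read from left to right, have increasing starting points. A permutation contains a pattern $\tau$ if it has a (not necessarily contiguous) subsequence order-isomorphic to $\tau$; otherwise it is $\tau$-avoiding. $\mathcal{F}(n;\tau_1,\tau_2)$ is the set of flattened partitions over $[n]$ avoiding both $\tau_1$ and $\tau_2$. The Fibonacci numbers satisfy $F_n=F_{n-1}+F_{n-2}$ for $n\ge 3$. *)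

(* Defs.v *)
From HB Require Import structures.
From mathcomp Require Import all_boot perm.
Set Implicit Arguments. Unset Strict Implicit. Unset Printing Implicit Defensive.

(* 'S_n acts on {0, ..., n-1}; the word of s is shifted to the alphabet [n]. *)
Definition word (n : nat) (s : 'S_n) : seq nat := [seq (s i).+1 | i <- enum 'I_n].

Fixpoint runs (w : seq nat) : seq (seq nat) :=
  if w is x :: w' then
    if runs w' is (y :: r) :: rs then
      if x < y then (x :: y :: r) :: rs else [:: x] :: (y :: r) :: rs
    else [:: [:: x]]
  else [::].

Definition run_starts (w : seq nat) : seq nat := [seq head 0 r | r <- runs w].

Definition flattened (n : nat) (s : 'S_n) : bool :=
  sorted ltn (run_starts (word s)).

Definition order_isomorphic (u t : seq nat) : bool :=
  (size u == size t) &&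
  [forall i : 'I_(size t), forall j : 'I_(size t),
     (nth 0 u i < nth 0 u j) == (nth 0 t i < nth 0 t j)].

(* The subsequences of w are the mask m w, for m a bit vector of length size w. *)
Definition contains_pattern (w t : seq nat) : bool :=
  [exists m : (size w).-tuple bool, order_isomorphic (mask m w) t].

Definition avoids (n : nat) (s : 'S_n) (t : seq nat) : bool :=
  ~~ contains_pattern (word s) t.

Definition flattened_avoiding (n : nat) (t1 t2 : seq nat) : {set 'S_n} :=
  [set s : 'S_n | [&& flattened s, avoids s t1 & avoids s t2]].

Fixpoint fib (n : nat) : nat :=
  match n with
  | 0 => 0
  | 1 => 1
  | (m.+1 as k).+1 => fib k + fib m
  end.

(* [runs w] is the decomposition of w into nonempty increasing blocks, which
   are maximal: no block can be merged with the next one. *)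
Lemma runs_spec (w : seq nat) :
  [/\ flatten (runs w) = w, [::] \notin runs w, all (sorted ltn) (runs w)
    & sorted (fun r1 r2 => head 0 r2 <= last 0 r1) (runs w)].
Proof.
elim: w => [|x w [IHw IHn IHs IHm]] //=.
case: (runs w) IHw IHn IHs IHm => [<- //|[//|y r] rs] /= <- IHn IHs IHm.
case: ifP => hxy; split=> //=.
- by rewrite hxy.
- by case: rs IHm {IHn IHs}.
- by rewrite leqNgt hxy.
Qed.

Lemma contains_patternP (w t : seq nat) :
  reflect (exists2 u, subseq u w & order_isomorphic u t) (contains_pattern w t).
Proof.
apply: (iffP existsP) => [[m hm]|[u /subseqP[m sz ->] hm]].
  by exists (mask m w) => //; exact: mask_subseq.
have szP : size m == size w by rewrite sz.
by exists (Tuple szP).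
Qed.

(* Main.v *)
Require Import Defs.
From mathcomp Require Import all_boot perm.
From mathcomp Require Import zify.
Set Implicit Arguments. Unset Strict Implicit. Unset Printing Implicit Defensive.

(** A permutation avoids 213 and 231 exactly when no entry has both a smaller
    and a larger entry to its right, that is, when every entry is the minimum
    or the maximum of the suffix that it begins ([avoids_extremal]).  Such a
    word is a sequence of choices between the least and the greatest remaining
    value.

    Being flattened restricts these choices.  The least value starts a run, so
    it must start the first run, and the word begins with its minimum
    ([flat_head_min]).  After a maximum a new run begins, whose starting point
    must be smaller than all later starting points; hence every entry that
    follows a maximum is a minimum again.  Conversely, if the word begins with
    its minimum and no two maxima are chosen in succession, each run starts at
    the minimum of the remaining suffix, and the starting points increase
    ([flat_min_min], [flat_min_max]).

    So a flattened avoider on an interval of [n.+2] values with least value [a]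
    is either [a] followed by one on the remaining [n.+1] values, or [a], then
    the greatest value, then one on the remaining [n] values.  This is the
    Fibonacci recurrence, and [fib_words] lists the words along it
    ([mem_fib_words], [size_fib_words], [uniq_fib_words]). *)

(** * Starting points of runs *)

Lemma run_starts_cons x w :
  run_starts (x :: w) = x :: behead (run_starts (x :: w)).
Proof.
rewrite /run_starts /=; case: (runs w) => [|[|y r] rs] //=.
by case: ifP.
Qed.

Lemma run_starts_cons2 x y w :
  run_starts [:: x, y & w] =
    x :: (if x < y then behead (run_starts (y :: w)) else run_starts (y :: w)).
Proof.
have [_ n0 _ _] := runs_spec (y :: w).
have := run_starts_cons y w; rewrite /run_starts.
have -> : runs [:: x, y & w] =
  if runs (y :: w) is (z :: r) :: rs then
    if x < z then (x :: z :: r) :: rs else [:: x] :: (z :: r) :: rs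
  else [:: [:: x]] by [].
by case: (runs (y :: w)) n0 => [|[|z r] rs] //= _ [->]; case: ifP.
Qed.

(** Each entry is at least the starting point of its own run. *)
Lemma all_leq_run_starts b w : all (leq b) (run_starts w) = all (leq b) w.
Proof.
elim: w => [|x [|y w] IH] //.
rewrite run_starts_cons2 [all _ (x :: _)]/= [RHS]/= -/(all (leq b) (y :: w)).
case bx: (b <= x) => //=; case: ifP => xy; last by rewrite IH.
by move: IH; rewrite run_starts_cons /= (leq_trans bx (ltnW xy)).
Qed.

Lemma behead_run_starts_subseq x w : subseq (behead (run_starts (x :: w))) w.
Proof.
elim: w x => [|y w IH] x //; rewrite run_starts_cons2 /=.
case: ifP => _; first exact: subseq_trans (IH y) (subseq_cons w y).
by rewrite run_starts_cons /= eqxx.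
Qed.

Definition flat (w : seq nat) : bool := sorted ltn (run_starts w).

(** The first starting point is the least one, and starting points bound all
    entries from below. *)
Lemma flat_head_min x w : flat (x :: w) -> all (leq x) (x :: w).
Proof.
rewrite /flat run_starts_cons /= path_sortedE; last exact: ltn_trans.
case/andP=> h _; rewrite -/(all (leq x) (x :: w)) -all_leq_run_starts.
rewrite run_starts_cons /= leqnn /=.
by apply: sub_all h => y; exact: ltnW.
Qed.

(** A minimum prepended to a word that starts with its own minimum joins the
    first run, and lowers the starting point of that run only. *)
Lemma flat_min_min x y w : x < y -> all (ltn y) w ->
  flat [:: x, y & w] = flat (y :: w).
Proof.
move=> xy yw; rewrite /flat run_starts_cons2 xy.
have := behead_run_starts_subseq y w; rewrite run_starts_cons /=.
set s := behead _ => sw.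
have ys : all (ltn y) s by apply/allP => z /(mem_subseq sw); exact: (allP yw).
have xs : all (ltn x) s by apply: sub_all ys => z; exact: ltn_trans.
by rewrite !path_sortedE ?xs ?ys //; exact: ltn_trans.
Qed.

(** The descent from [y] to [z] closes the run [x y], and the starting point
    [x] of this run lies below all later ones. *)
Lemma flat_min_max x y z w : x < y -> z < y -> all (ltn x) (z :: w) ->
  flat [:: x, y, z & w] = flat (z :: w).
Proof.
move=> xy zy xw; rewrite /flat run_starts_cons2 xy run_starts_cons2.
rewrite [y < z]ltnNge (ltnW zy) /= path_sortedE; last exact: ltn_trans.
by rewrite (all_leq_run_starts x.+1) xw.
Qed.

(** * Avoidance of 213 and 231 *)

Fixpoint extremal (w : seq nat) : bool :=
  if w is x :: w' then (all (ltn x) w' || all (gtn x) w') && extremal w'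
  else true.

Lemma extremal_subseq u w : subseq u w -> extremal w -> extremal u.
Proof.
elim: w u => [|x w IH] [|y u] //= sub /andP[h e].
move: sub; case: eqP => [->|_] sub; last exact: IH sub e.
rewrite (IH _ sub e) andbT.
by case/orP: h => /(allP) h; apply/orP; [left|right];
  apply/allP => z /(mem_subseq sub) /h.
Qed.

Lemma order_isomorphic_213 u :
  reflect (exists x y z, u = [:: x; y; z] /\ y < x < z)
          (order_isomorphic u [:: 2; 1; 3]).
Proof.
apply: (iffP andP) => [[/eqP sz /forallP h]|[x [y [z [-> /andP[yx xz]]]]]].
  case: u sz h => [|x [|y [|z [|]]]] //= _ h.
  have /eqP /= yx := forallP (h (inord 1)) (inord 0).
  have /eqP /= xz := forallP (h (inord 0)) (inord 2).
  rewrite !inordK //= in yx xz.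
  by exists x, y, z; rewrite yx xz.
split=> //; apply/forallP => -[[|[|[|//]]] ?]; apply/forallP => -[[|[|[|//]]] ?];
  by apply/eqP => /=; lia.
Qed.

Lemma order_isomorphic_231 u :
  reflect (exists x y z, u = [:: x; y; z] /\ z < x < y)
          (order_isomorphic u [:: 2; 3; 1]).
Proof.
apply: (iffP andP) => [[/eqP sz /forallP h]|[x [y [z [-> /andP[zx xy]]]]]].
  case: u sz h => [|x [|y [|z [|]]]] //= _ h.
  have /eqP /= zx := forallP (h (inord 2)) (inord 0).
  have /eqP /= xy := forallP (h (inord 0)) (inord 1).
  rewrite !inordK //= in zx xy.
  by exists x, y, z; rewrite zx xy.
split=> //; apply/forallP => -[[|[|[|//]]] ?]; apply/forallP => -[[|[|[|//]]] ?];
  by apply/eqP => /=; lia.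
Qed.

Lemma subseq_pair (T : eqType) (y z : T) w :
  y \in w -> z \in w -> y != z -> subseq [:: y; z] w || subseq [:: z; y] w.
Proof.
elim: w => [|x w IH] //; rewrite !inE => yw zw yz /=.
case: (eqVneq y x) yw yz => [->|yx] /= yw yz.
  by move: zw; rewrite eq_sym (negPf yz) /= sub1seq => ->.
case: (eqVneq z x) zw yz => [->|zx] /= zw yz; first by rewrite sub1seq yw orbT.
exact: IH.
Qed.

(** Extremality passes to subsequences and fails for 213 and 231.  Conversely,
    a suffix [x :: w] with [x] neither minimal nor maximal has an entry [y < x]
    and an entry [z > x]; the order in which these occur decides between 213
    and 231. *)
Lemma avoids_extremal w : uniq w ->
  ~~ contains_pattern w [:: 2; 1; 3] && ~~ contains_pattern w [:: 2; 3; 1]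
    = extremal w.
Proof.
move=> uw; rewrite -negb_or; apply/idP/idP; last first.
  move=> e; apply/orP => -[] /contains_patternP[u uw'].
    case/order_isomorphic_213 => x [y [z [eu h]]].
    by have := extremal_subseq uw' e; rewrite eu /=; lia.
  case/order_isomorphic_231 => x [y [z [eu h]]].
  by have := extremal_subseq uw' e; rewrite eu /=; lia.
elim: w uw => [|x w IH] //= /andP[xw uw] h; apply/andP; split; last first.
  apply: IH uw _; apply: contra h => /orP[] /contains_patternP[u su ou];
    apply/orP; [left|right]; apply/contains_patternP; exists u => //;
    exact: subseq_trans su (subseq_cons w x).
apply: contraR h; rewrite negb_or => /andP[/allPn[y yw yx] /allPn[z zw zx]].
have neqx t : t \in w -> t != x by apply: contraTneq => ->.
have := neqx y yw; have := neqx z zw; move=> zx' yx'.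
have yz : y != z by move: yx zx zx' yx' => /=; lia.
have /orP[s|s] := subseq_pair yw zw yz; apply/orP; [left|right];
  apply/contains_patternP.
  exists [:: x; y; z]; first by rewrite /= eqxx.
  apply/order_isomorphic_213; exists x, y, z; split=> //.
  by move: yx zx zx' yx' => /=; lia.
exists [:: x; z; y]; first by rewrite /= eqxx.
apply/order_isomorphic_231; exists x, z, y; split=> //.
by move: yx zx zx' yx' => /=; lia.
Qed.

(** * The flattened avoiders of an interval *)

(** There is no word of length 0 here, so that a word of length 2 arises only
    from the branch that continues with a minimum: its last entry is both the
    minimum and the maximum of its suffix. *)
Fixpoint fib_words (n a : nat) : seq (seq nat) :=
  match n with
  | 0 => [::]
  | 1 => [:: [:: a]]
  | (m.+1 as k).+1 =>
      [seq a :: v | v <- fib_words k a.+1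
                         ++ [seq (a + k) :: v | v <- fib_words m a.+1]]
  end.

Lemma fib_wordsSS m a :
  fib_words m.+2 a =
    [seq a :: v | v <- fib_words m.+1 a.+1
                       ++ [seq (a + m.+1) :: v | v <- fib_words m a.+1]].
Proof. by []. Qed.

Lemma fib_ind (P : nat -> Prop) :
  P 0 -> P 1 -> (forall m, P m -> P m.+1 -> P m.+2) -> forall n, P n.
Proof.
move=> P0 P1 PS n; suff: P n /\ P n.+1 by case.
by elim: n => [|n [? ?]]; split=> //; exact: PS.
Qed.

Lemma size_fib_words n a : size (fib_words n a) = fib n.
Proof.
elim/fib_ind: n a => // m IH0 IH1 a.
by rewrite fib_wordsSS size_map size_cat size_map IH0 IH1.
Qed.

Lemma head_fib_words n a v : v \in fib_words n a -> head 0 v = a.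
Proof.
case: n => [|[|m]] //; first by rewrite inE => /eqP ->.
by rewrite fib_wordsSS => /mapP[u _ ->].
Qed.

Lemma uniq_fib_words n a : uniq (fib_words n a).
Proof.
have inj (b : nat) : injective (cons b) by move=> u v [].
elim/fib_ind: n a => // m IH0 IH1 a.
rewrite fib_wordsSS (map_inj_uniq (inj a)) cat_uniq IH1.
rewrite (map_inj_uniq (inj _)) IH0 andbT andTb.
apply/hasPn => _ /mapP[v vm ->]; apply/negP => /head_fib_words /=.
by case: m vm {IH0 IH1} => // m _; lia.
Qed.

Lemma perm_iota_max a m u :
  perm_eq (a + m.+1 :: u) (iota a.+1 m.+1) = perm_eq u (iota a.+1 m).
Proof.
rewrite -[in iota _ m.+1](addn1 m) iotaD /= addSnnS.
rewrite -(perm_cons (a + m.+1) u) perm_sym [RHS]perm_sym.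
by rewrite (perm_catC (iota a.+1 m) [:: a + m.+1]).
Qed.

Lemma perm_iota_mem a m u : perm_eq u (iota a m) ->
  forall t, (t \in u) = (a <= t < a + m).
Proof. by move=> pu t; rewrite (perm_mem pu) mem_iota. Qed.

(** The second entry decides the branch.  If it is a maximum, the entry after
    it starts a new run, so the suffix from there on is flattened in its own
    right and thus starts with its own minimum. *)
Lemma mem_fib_words n a w :
  (w \in fib_words n a) =
    [&& 0 < n, perm_eq w (iota a n), flat w & extremal w].
Proof.
elim/fib_ind: n a w => [//|a w|m IH0 IH1 a w].
  rewrite inE /=; apply/eqP/idP => [->|]; first by rewrite perm_refl.
  by case/and3P => pw _ _; apply: perm_small_eq pw.
have lta u k : perm_eq u (iota a.+1 k) -> all (ltn a) u.
  by move=> /perm_iota_mem pu; apply/allP => t; rewrite pu => /andP[].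
have iotaS : iota a m.+2 = a :: iota a.+1 m.+1 by [].
rewrite fib_wordsSS; apply/mapP/idP => [[v + ->]|].
  rewrite mem_cat => /orP[|/mapP[u + ->]].
    rewrite IH1 => /and4P[_ pv fv ev]; have av := lta _ _ pv.
    rewrite iotaS perm_cons pv /= ev av !andbT /=.
    case: v pv fv ev av => [|y v] // pv fv _ /= /andP[ay _].
    rewrite flat_min_min //; have /= /andP[_ yv] := flat_head_min fv.
    have := perm_uniq pv; rewrite iota_uniq /= => /andP[yv' _].
    apply/allP => t tv /=; rewrite ltn_neqAle (allP yv) // andbT.
    by apply: contraNneq yv' => ->.
  rewrite IH0 => /and4P[m0 pu fu eu]; have au := lta _ _ pu.
  have um : all (gtn (a + m.+1)) u.
    by apply/allP => t; rewrite (perm_iota_mem pu) /=; lia.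
  rewrite iotaS perm_cons perm_iota_max pu /= um eu au orbT !andbT /=.
  have am : a < a + m.+1 by lia.
  rewrite am andbT /=.
  case: u pu fu eu au um => [/perm_size /=|z u _ fu _ au /= /andP[zm _]].
    by rewrite size_iota => m_0; rewrite -m_0 in m0.
  by rewrite flat_min_max.
case/and4P => _ pw fw ew.
case: w pw fw ew => [/perm_size //|x w pw fw /= /andP[_ ew]].
have xa : x = a.
  have /allP/(_ a) := flat_head_min fw; have := perm_iota_mem pw.
  move=> pm; rewrite pm leqnn /=; have := pm x; rewrite inE eqxx /=; lia.
move: pw fw; rewrite {x}xa iotaS perm_cons => pw fw; exists w => //.
rewrite mem_cat.
case: w pw fw ew => [/perm_size //|y w pw fw ew].
have /= /andP[ay aw] := lta _ _ pw.
case yw: (all (ltn y) w).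
  by rewrite IH1 pw ew -(flat_min_min ay yw) fw.
have /andP[wy ew'] : all (gtn y) w && extremal w by move: ew; rewrite /= yw.
case: w yw pw fw ew' aw wy {ew} => [//|z w] _ pw fw ezw aw wy.
(* The case left is that of a maximum [y] that is not the last entry. *)
have ym : y = a + m.+1.
  have pm := perm_iota_mem pw.
  have := pm y; have := pm (a + m.+1); rewrite !inE eqxx /=.
  case: eqVneq => [->//|_] /=; rewrite -in_cons.
  have [t|_] := boolP (_ \in _); last by lia.
  by have := allP wy _ t; rewrite /=; lia.
have /= /andP[zy _] := wy.
move: fw; rewrite flat_min_max // => fw.
move: pw; rewrite ym perm_iota_max => pw.
rewrite orbC map_f // IH0 pw fw ezw !andbT /=.
by have := perm_size pw; rewrite size_iota => <-.
Qed.

(** * Permutations and their words *)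

Lemma word_inj n : injective (@word n).
Proof.
move=> s t /eq_in_map h; apply/permP => i; apply: val_inj.
by have [] := h i (mem_enum _ i).
Qed.

Lemma perm_word n (s : 'S_n) : perm_eq (word s) (iota 1 n).
Proof.
have -> : iota 1 n = [seq (i : 'I_n).+1 | i <- enum 'I_n].
  by rewrite -[1]addn0 iotaDl -val_enum_ord -map_comp.
rewrite /word (map_comp (fun i : 'I_n => i.+1) s); apply: perm_map.
apply: uniq_perm; rewrite ?enum_uniq //.
  by rewrite map_inj_uniq ?enum_uniq //; exact: perm_inj.
move=> i; rewrite mem_enum; apply/mapP; exists (s^-1%g i); rewrite ?mem_enum //.
by rewrite permKV.
Qed.

Lemma word_surj n w : perm_eq w (iota 1 n) -> exists s : 'S_n, word s = w.
Proof.
move=> pw; have sw : size w = n by rewrite (perm_size pw) size_iota.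
have nthw (i : 'I_n) : 0 < nth 0 w i < n.+1.
  by rewrite -(perm_iota_mem pw) mem_nth ?sw.
have lt (i : 'I_n) : (nth 0 w i).-1 < n by have := nthw i; lia.
have inj : injective (fun i : 'I_n => Ordinal (lt i)).
  have uw : uniq w by rewrite (perm_uniq pw) iota_uniq.
  move=> i j [] /= e; apply/val_inj/(uniqP 0 uw); rewrite ?inE ?sw ?ltn_ord //=.
  have /andP[i0 _] := nthw i; have /andP[j0 _] := nthw j.
  by rewrite -(prednK i0) -(prednK j0) e.
exists (perm inj); rewrite -[RHS](mkseq_nth 0) /mkseq sw -val_enum_ord -map_comp.
by apply: eq_map => i; rewrite permE /= prednK //; case/andP: (nthw i).
Qed.

Theorem proposition3p3 (n : nat) (hn : 1 <= n) :
  #|flattened_avoiding n [:: 2; 1; 3] [:: 2; 3; 1]| = fib n.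
Proof.
rewrite -(size_fib_words n 1) cardE -(size_map (@word n)).
apply: perm_size; apply: uniq_perm (uniq_fib_words n 1) _.
  by rewrite (map_inj_uniq (@word_inj n)) enum_uniq.
have avoidsE (s : 'S_n) :
    avoids s [:: 2; 1; 3] && avoids s [:: 2; 3; 1] = extremal (word s).
  by apply: avoids_extremal; rewrite (perm_uniq (perm_word s)) iota_uniq.
move=> w; rewrite mem_fib_words hn /=.
apply/mapP/idP => [[s + ->]|/and3P[/word_surj[s <-] fs es]].
  by rewrite mem_enum inE avoidsE perm_word.
by exists s => //; rewrite mem_enum inE avoidsE es andbT.
Qed.
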